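(* Let $S$ be a language, $D$ a ruleset of $S$ and $X$ a set. Suppose $D$ emulates from $\emptyset$ the ruleset $\{R_0,R_=,R_\leftrightarrow,R_\Rightarrow,R_+,R_{\mathcal R},R_\downarrow,R_{\exists\rightarrow}\}$, $X$ is a mincover, $\mathrm{Prov}_D(X)\subseteq X$, and $X$ is witnessed. Then for every formula $\varphi$ of $S$, $\varphi$ evaluates to $1$ in the Henkin interpretation $H_{D,X}$ if and only if $\varphi\in X$.
   Context: Language $S$: integer-valued arity $\#$, $\equiv\in\operatorname{dom}\#$ with $\#(\equiv)=-2$, $\downarrow\notin\operatorname{dom}\#$, infinitely many literals ($\#=0$); strings concatenated by juxtaposition. Terms: literals and $s\,t_1\cdots t_n$ ($\#(s)=n>0$). Formulas: atomic $r\,t_1\cdots t_n$ ($\#(r)=-n<0$), $\downarrow\varphi\psi$ (NOR), $v\varphi$ ($v$ literal; existential). $\neg\varphi:=\downarrow\varphi\varphi$. $\psi[v_1/v_2]$: replace each occurrence of literal $v_1$ by $v_2$. $\psi[v:=t]$: replace $v$ by $t$ in argument terms of atomic formulas, commute with $\downarrow$, and $(v_1\varphi)[v:=t]=v'(\varphi[v_1/v'])[v:=t]$ with $v'\ne v$ a literal not occurring in $t,\varphi$. Interpretations: nonempty universe $U$, $s$ with $\#(s)\ge0$ gets $U^{\#(s)}\to U$, $s$ with $\#(s)<0$ gets $U^{-\#(s)}\to\{0,1\}$; evaluation usual ($\equiv$ equality, $\downarrow$ NOR, $v\varphi$ existential over reassignments of $v$). Sequents $(\Gamma,\varphi)$,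 $\Gamma$ finite set of formulas; rules are maps on sets of sequents; $O_D(\Sigma)=\bigcup_{R\in D}R(\Sigma)$ with iterates $O^n_D$; $X\vdash_D\varphi$ iff $(\Gamma,\varphi)\in O^n_D(\emptyset)$ for some $n$ and finite $\Gamma\subseteq X$; $\mathrm{Prov}_D(X)=\{\varphi:X\vdash_D\varphi\}$. $D$ emulates $D'$ from $\emptyset$ if $\bigcup_{n\ge1}O^n_{D'}(\emptyset)\subseteq\bigcup_{n\ge1}O^n_D(\emptyset)$. Rules ($t$'s terms, $\varphi$'s,$\psi$ formulas): $R_0(\Sigma)=\{(\{\varphi\},\varphi)\}$; $R_=(\Sigma)=\{(\emptyset,\equiv tt)\}$; $R_\leftrightarrow(\Sigma)=\{(\{\equiv t_1t_2\},\equiv t_2t_1)\}$; $R_\Rightarrow(\Sigma)=\{(\{\equiv t_1t_2,\equiv t_2t_3\},\equiv t_1t_3)\}$; $R_+(\Sigma)=\{(\{\equiv t_jt'_j:j\le n\},\equiv st_1\cdots t_nst'_1\cdots t'_n):\#(s)=n>0\}$; $R_{\mathcal R}(\Sigma)=\{(\{\equiv t_jt'_j:j\le n\}\cup\{rt_1\cdots t_n\},rt'_1\cdots t'_n):\#(r)=-n<0\}$; $R_\downarrow(\Sigma)=\{(\{\downarrow\varphi_1\varphi_2,\downarrow\varphi_3\varphi_4\},\downarrow\varphi_2\varphi_3)\}$; $R_{\exists\rightarrow}(\Sigma)=\{(\{\psi[v:=t]\},v\psi)\}$. $X$ is a mincover if for every formula $\varphi$: $\varphi\in X$ iff $\neg\varphi\notin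 X$. $X$ is witnessed if for every formula of the form $v_1\varphi\in X$ there is a literal $v_2$ not occurring in $\varphi$ with $\varphi[v_1/v_2]\in X$. Henkin interpretation: let $t_1\sim t_2$ iff $X\vdash_D\ \equiv t_1t_2$ (for terms $t_1,t_2$). $H_{D,X}$ is the quotient of the free interpretation by $\sim$: its universe is the set of $\sim$-classes $[t]$ of terms, $H_{D,X}(s)([t_1],\dots,[t_n])=[s\,t_1\cdots t_n]$ for $\#(s)=n\ge0$, and $H_{D,X}(r)([t_1],\dots,[t_n])=1$ iff $r\,t_1\cdots t_n\in X$, for $\#(r)=-n<0$ (under the hypotheses of the claim, $\sim$ is an equivalence relation and these assignments are well defined). *)

(* Defs.v *)
From HB Require Import structures.
From mathcomp Require Import all_boot all_order all_algebra finmap.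
From mathcomp Require Import boolp classical_sets functions cardinality.

Set Implicit Arguments.
Unset Strict Implicit.
Unset Printing Implicit Defensive.

Import Order.TTheory GRing.Theory Num.Theory.
Local Open Scope classical_set_scope.

(* [symbol] is the domain of the arity map.  The connective NOR is not a       *)
(* symbol: it is the constructor [Nor] of formulas below.                      *)
Record language := Language {
  symbol : eqType;
  arity : symbol -> int;
  equ : symbol;
  arity_equ : arity equ = (- 2)%R;
  literals_infinite : infinite_set [set s | arity s = 0%R]
}.

Section Syntax.
Variable S : language.

Definition literal := {s : symbol S | arity s == 0%R}.
Definition opsym := {s : symbol S | (0 < arity s)%R}.
Definition relsym := {s : symbol S | (arity s < 0)%R}.

Definition nargs (s : symbol S) : nat := `|arity s|%N.

(* Strings in Polish notation being uniquely readable, terms and formulas are  *)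
(* represented by their syntax trees.                                          *)
Inductive term : Type :=
| Lit (v : literal)
| App (s : opsym) (ts : 'I_(nargs (sval s)) -> term).

Inductive formula : Type :=
| Atom (r : relsym) (ts : 'I_(nargs (sval r)) -> term)
| Nor (phi psi : formula)
| Ex (v : literal) (phi : formula).

HB.instance Definition _ := gen_eqMixin formula.
HB.instance Definition _ := gen_choiceMixin formula.

Definition Neg (phi : formula) : formula := Nor phi phi.

Lemma equ_rel_subproof : (arity (equ S) < 0)%R.
Proof. by rewrite arity_equ. Qed.

Definition equ_rel : relsym := exist _ (equ S) equ_rel_subproof.

(* [nargs (equ S)] is 2, though not by conversion: position 0 holds [t1] and   *)
(* the only other position, 1, holds [t2].                                     *)
Definition Equ (t1 t2 : term) : formula :=
  @Atom equ_rel (fun i => if val i == 0 then t1 else t2).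

Fixpoint occurs_term (v : literal) (t : term) : bool :=
  match t with
  | Lit w => v == w
  | App s ts => [exists i, occurs_term v (ts i)]
  end.

(* An occurrence is an occurrence in the string, so binders count.             *)
Fixpoint occurs (v : literal) (phi : formula) : bool :=
  match phi with
  | Atom r ts => [exists i, occurs_term v (ts i)]
  | Nor phi1 phi2 => occurs v phi1 || occurs v phi2
  | Ex w phi1 => (v == w) || occurs v phi1
  end.

(* Replacement of every occurrence of the literal v1 by v2, binders included:  *)
(* psi[v1/v2].                                                                 *)
Definition rename_lit (v1 v2 w : literal) : literal :=
  if w == v1 then v2 else w.

Fixpoint rename_term (v1 v2 : literal) (t : term) : term :=
  match t with
  | Lit w => Lit (rename_lit v1 v2 w)
  | App s ts => @App s (fun i => rename_term v1 v2 (ts i))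
  end.

Fixpoint rename (v1 v2 : literal) (phi : formula) : formula :=
  match phi with
  | Atom r ts => @Atom r (fun i => rename_term v1 v2 (ts i))
  | Nor phi1 phi2 => Nor (rename v1 v2 phi1) (rename v1 v2 phi2)
  | Ex w phi1 => Ex (rename_lit v1 v2 w) (rename v1 v2 phi1)
  end.

Fixpoint subst_term (v : literal) (t : term) (u : term) : term :=
  match u with
  | Lit w => if w == v then t else Lit w
  | App s us => @App s (fun i => subst_term v t (us i))
  end.

(* A choice of the literal v' used in (v1 phi)[v := t], as a function of v1,   *)
(* phi, v and t.                                                               *)
Record fresh_choice := FreshChoice {
  fresh :> literal -> formula -> literal -> term -> literal;
  freshP : forall v1 phi v t,
    [/\ fresh v1 phi v t != v,
        ~~ occurs_term (fresh v1 phi v t) t &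
        ~~ occurs (fresh v1 phi v t) phi]
}.

Fixpoint height (phi : formula) : nat :=
  match phi with
  | Atom _ _ => 0
  | Nor phi1 phi2 => (maxn (height phi1) (height phi2)).+1
  | Ex _ phi1 => (height phi1).+1
  end.

(* The recursion goes through a renamed subformula, hence the bound [n] on the *)
(* height; the intended equations are [subst_Atom], [subst_Nor] and            *)
(* [subst_Ex].                                                                 *)
Fixpoint subst_rec (fr : fresh_choice) (n : nat) (v : literal) (t : term)
    (phi : formula) : formula :=
  match phi, n with
  | Atom r ts, _ => @Atom r (fun i => subst_term v t (ts i))
  | Nor phi1 phi2, n'.+1 =>
      Nor (subst_rec fr n' v t phi1) (subst_rec fr n' v t phi2)
  | Ex v1 phi1, n'.+1 =>
      let v' := fr v1 phi1 v t in
      Ex v' (subst_rec fr n' v t (rename v1 v' phi1))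
  | _, 0 => phi
  end.

(* psi[v := t] *)
Definition subst (fr : fresh_choice) (v : literal) (t : term) (psi : formula) :=
  subst_rec fr (height psi) v t psi.

Lemma height_rename v1 v2 phi : height (rename v1 v2 phi) = height phi.
Proof. by elim: phi => //= [phi1 -> phi2 ->|_ phi1 ->]. Qed.

Lemma subst_rec_height (fr : fresh_choice) n v t phi :
  height phi <= n -> subst_rec fr n v t phi = subst fr v t phi.
Proof.
have wd m : forall k p, height p <= m -> height p <= k ->
    subst_rec fr m v t p = subst_rec fr k v t p.
  elim: m => [|m IH] [|k] [r ts|p q|w p] //=; rewrite !ltnS.
  - rewrite !geq_max => /andP[pm qm] /andP[pk qk].
    by rewrite (IH k p) // (IH k q).
  - by move=> pm pk; rewrite (IH k) // height_rename.
by move=> phin; rewrite /subst; apply: wd.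
Qed.

Lemma subst_Atom (fr : fresh_choice) v t (r : relsym) (ts : 'I_(nargs (sval r)) -> term) :
  subst fr v t (Atom ts) = Atom (fun i => subst_term v t (ts i)).
Proof. by []. Qed.

Lemma subst_Nor (fr : fresh_choice) v t phi1 phi2 :
  subst fr v t (Nor phi1 phi2) = Nor (subst fr v t phi1) (subst fr v t phi2).
Proof.
by rewrite /subst /= !subst_rec_height // (leq_maxl, leq_maxr).
Qed.

Lemma subst_Ex (fr : fresh_choice) v t v1 phi : let v' := fr v1 phi v t in
  subst fr v t (Ex v1 phi) = Ex v' (subst fr v t (rename v1 v' phi)).
Proof. by rewrite /subst /= height_rename. Qed.

Lemma finite_occurs_term (t : term) : finite_set [set v | occurs_term v t].
Proof.
elim: t => [w|s ts IH].
  by apply: sub_finite_set (finite_set1 w) => v /= /eqP.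
apply: sub_finite_set (bigcup_finite (@finite_finset _ [set: _]) (fun i _ => IH i)).
by move=> v /= /existsP[i vi]; exists i.
Qed.

Lemma finite_occurs (phi : formula) : finite_set [set v | occurs v phi].
Proof.
elim: phi => [r ts|p IHp q IHq|w p IH].
- have /sub_finite_set := bigcup_finite (@finite_finset _ [set: _])
    (fun i _ => finite_occurs_term (ts i)).
  by apply=> v /= /existsP[i vi]; exists i.
- apply: sub_finite_set (_ : finite_set ([set v | occurs v p] `|` _)); last first.
    by rewrite finite_setU; split; [exact: IHp|exact: IHq].
  by move=> v /= /orP[]; [left|right].
- apply: sub_finite_set (_ : finite_set ([set w] `|` [set v | occurs v p])).
    by move=> v /= /orP[/eqP|]; [left|right].
  by rewrite finite_setU; split.
Qed.

Lemma fresh_choice_inhabited : inhabited fresh_choice.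
Proof.
have H (v1 : literal) phi v t : exists v' : literal,
    [/\ v' != v, ~~ occurs_term v' t & ~~ occurs v' phi].
  have infl : infinite_set [set: literal].
    move=> fin; apply: (@literals_infinite S).
    apply: sub_finite_set (finite_image sval fin) => s /= /eqP s0.
    by exists (exist _ s s0).
  have fin : finite_set ([set v] `|` ([set w | occurs_term w t] `|`
                                      [set w | occurs w phi])).
    by rewrite !finite_setU; split=> //; split;
       [exact: finite_occurs_term|exact: finite_occurs].
  have [v' [_ nv']] := infinite_setN0 (infinite_setD infl fin).
  exists v'; split; apply/negP => Hv'; apply: nv'.
  - by left; apply/eqP.
  - by right; left.
  - by right; right.
exact: inhabits (@FreshChoice (fun v1 phi v t => projT1 (cid (H v1 phi v t)))
  (fun v1 phi v t => projT2 (cid (H v1 phi v t)))).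
Qed.

End Syntax.

Section Semantics.
Variable S : language.

(* U^n is ['I_n -> U], and U^0 -> U is identified with U.                      *)
Record interpretation := Interpretation {
  universe : Type;
  universe_nonempty : inhabited universe;
  ilit : literal S -> universe;
  iop : forall s : opsym S, ('I_(nargs (sval s)) -> universe) -> universe;
  irel : forall r : relsym S, ('I_(nargs (sval r)) -> universe) -> bool
}.

Definition reassign (I : interpretation) (v : literal S) (u : universe I) :=
  @Interpretation (universe I) (universe_nonempty I)
    (fun w => if w == v then u else ilit I w) (@iop I) (@irel I).

Fixpoint eval_term (I : interpretation) (t : term S) : universe I :=
  match t with
  | Lit v => ilit I v
  | App s ts => iop (fun i => eval_term I (ts i))
  end.

Definition eval_atom (I : interpretation) (r : relsym S)
    (us : 'I_(nargs (sval r)) -> universe I) : bool :=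
  if r == equ_rel S
  (* the argument in position 0 equals the one in position 1 *)
  then `[< forall i j, val i = 0 -> val j = 1 -> us i = us j >]
  else irel us.

Fixpoint eval (I : interpretation) (phi : formula S) : bool :=
  match phi with
  | Atom r ts => eval_atom (fun i => eval_term I (ts i))
  | Nor phi1 phi2 => ~~ (eval I phi1 || eval I phi2)
  | Ex v phi1 => `[< exists u : universe I, eval (reassign v u) phi1 >]
  end.

End Semantics.

Section Deduction.
Variable S : language.

Definition sequent := ({fset formula S} * formula S)%type.
Definition rule := set sequent -> set sequent.
Definition ruleset := set rule.

Definition step (D : ruleset) (Sigma : set sequent) : set sequent :=
  \bigcup_(R in D) R Sigma.

Definition provable (D : ruleset) (X : set (formula S)) (phi : formula S) :=
  exists (n : nat) (Gamma : {fset formula S}),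
    [set` Gamma] `<=` X /\ iter n (step D) set0 (Gamma, phi).

Definition Prov (D : ruleset) (X : set (formula S)) : set (formula S) :=
  [set phi | provable D X phi].

Definition emulates_from_empty (D D' : ruleset) :=
  \bigcup_(n in [set n | 1 <= n]) iter n (step D') set0 `<=`
  \bigcup_(n in [set n | 1 <= n]) iter n (step D) set0.

Definition R_assume : rule := fun _ =>
  [set q | exists phi, q = ([fset phi]%fset, phi)].

Definition R_refl : rule := fun _ =>
  [set q | exists t, q = (fset0%fset, Equ t t)].

Definition R_sym : rule := fun _ =>
  [set q | exists t1 t2, q = ([fset Equ t1 t2]%fset, Equ t2 t1)].

Definition R_trans : rule := fun _ =>
  [set q | exists t1 t2 t3,
     q = ([fset Equ t1 t2; Equ t2 t3]%fset, Equ t1 t3)].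

Definition R_plus : rule := fun _ =>
  [set q | exists (s : opsym S) (ts ts' : 'I_(nargs (sval s)) -> term S),
     q = ([fset Equ (ts j) (ts' j) | j in 'I_(nargs (sval s))]%fset,
          Equ (App ts) (App ts'))].

Definition R_rel : rule := fun _ =>
  [set q | exists (r : relsym S) (ts ts' : 'I_(nargs (sval r)) -> term S),
     q = (([fset Equ (ts j) (ts' j) | j in 'I_(nargs (sval r))]
            `|` [fset Atom ts])%fset,
          Atom ts')].

Definition R_nor : rule := fun _ =>
  [set q | exists phi1 phi2 phi3 phi4,
     q = ([fset Nor phi1 phi2; Nor phi3 phi4]%fset, Nor phi2 phi3)].

Definition R_exists (fr : fresh_choice S) : rule := fun _ =>
  [set q | exists psi v t, q = ([fset subst fr v t psi]%fset, Ex v psi)].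

Definition base_rules (fr : fresh_choice S) : ruleset :=
  [set R_assume; R_refl; R_sym; R_trans; R_plus; R_rel; R_nor; R_exists fr].

Definition mincover (X : set (formula S)) :=
  forall phi, X phi <-> ~ X (Neg phi).

Definition witnessed (X : set (formula S)) :=
  forall v1 phi, X (Ex v1 phi) ->
    exists v2, ~~ occurs v2 phi /\ X (rename v1 v2 phi).

End Deduction.

Section Henkin.
Variables (S : language) (D : ruleset S) (X : set (formula S)).

Definition henkin_sim (t1 t2 : term S) := provable D X (Equ t1 t2).

Definition henkin_class (t : term S) : set (term S) :=
  [set u | henkin_sim t u].

Definition henkin_universe := {C : set (term S) | exists t, C = henkin_class t}.

Definition henkin_proj (t : term S) : henkin_universe :=
  exist _ (henkin_class t) (ex_intro _ t erefl).

Lemma henkin_nonempty : inhabited henkin_universe.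
Proof.
have /infinite_setN0[s /= /eqP s0] := @literals_infinite S.
exact: (inhabits (henkin_proj (Lit (exist _ s s0)))).
Qed.

Definition henkin_repr (C : henkin_universe) : term S := projT1 (cid (projT2 C)).

(* The operations are computed on arbitrary representatives of the classes;    *)
(* they satisfy the equations of the quotient, [henkin_iop] and [henkin_irel], *)
(* whenever these make sense.                                                  *)
Definition henkin : interpretation S :=
  @Interpretation S henkin_universe henkin_nonempty
    (fun v => henkin_proj (Lit v))
    (fun s us => henkin_proj (App (fun i => henkin_repr (us i))))
    (fun r us => `[< X (Atom (fun i => henkin_repr (us i))) >]).

Hypothesis sim_refl : forall t, henkin_sim t t.
Hypothesis sim_sym : forall t1 t2, henkin_sim t1 t2 -> henkin_sim t2 t1.
Hypothesis sim_trans : forall t1 t2 t3,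
  henkin_sim t1 t2 -> henkin_sim t2 t3 -> henkin_sim t1 t3.

Lemma henkin_projP t1 t2 : henkin_proj t1 = henkin_proj t2 <-> henkin_sim t1 t2.
Proof.
split=> [/(congr1 sval)/= e|H].
  by have : henkin_class t2 t2 := sim_refl t2; rewrite -e.
apply: eq_exist; apply/seteqP; split=> u Hu; last exact: sim_trans Hu.
exact: sim_trans (sim_sym H) Hu.
Qed.

Lemma henkin_reprP t : henkin_sim (henkin_repr (henkin_proj t)) t.
Proof.
rewrite /henkin_repr; case: cid => u /= e.
by have : henkin_class u u := sim_refl u; rewrite -e => /sim_sym.
Qed.

Lemma henkin_iop (s : opsym S) (ts : 'I_(nargs (sval s)) -> term S) :
  (forall us us' : 'I_(nargs (sval s)) -> term S,
    (forall i, henkin_sim (us i) (us' i)) -> henkin_sim (App us) (App us')) ->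
  @iop S henkin s (fun i => henkin_proj (ts i)) = henkin_proj (App ts).
Proof. by move=> cong; apply/henkin_projP/cong => i; apply: henkin_reprP. Qed.

Lemma henkin_irel (r : relsym S) (ts : 'I_(nargs (sval r)) -> term S) :
  (forall us us' : 'I_(nargs (sval r)) -> term S,
    (forall i, henkin_sim (us i) (us' i)) -> X (Atom us) -> X (Atom us')) ->
  @irel S henkin r (fun i => henkin_proj (ts i)) = true <-> X (Atom ts).
Proof.
move=> cong; split=> [/asboolP|H]; last apply/asboolP.
  by apply: cong => i; apply: henkin_reprP.
by apply: cong H => i; apply/sim_sym/henkin_reprP.
Qed.

End Henkin.

(* Main.v *)
Require Import Defs.
From mathcomp Require Import all_boot all_order all_algebra finmap.
From mathcomp Require Import boolp classical_sets.
Local Open Scope classical_set_scope.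

(** By induction on the height of a formula.  The sequents of the base rules
    do not depend on the input set, so they are all derived by [D] and [X] is
    closed under them.  Hence terms evaluate to their own classes, which settles
    atomic formulas; closure under [R_nor] makes a mincover commute with NOR.
    For a formula [v phi], witnesses and the renaming lemma give one direction,
    the substitution lemma and [R_exists] the other; renaming and substitution
    both preserve height, so the induction hypothesis applies to them. *)

(** * Evaluation under renaming and substitution of literals *)

Section Evaluation.
Variable S : language.
Implicit Types (I : interpretation S) (t : term S) (phi : formula S).
Implicit Types v w : literal S.

(* The reassignments of [I] all share the universe, operations and relations of
   [I]; in this form their universes are convertible, which lets equations
   between evaluations be stated without casts. *)
Definition with_lits I (e : literal S -> universe I) : interpretation S :=
  @Interpretation S (universe I) (universe_nonempty I) e (@iop S I) (@irel S I).

Definition update (T : Type) (e : literal S -> T) v (u : T) : literal S -> T :=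
  fun w => if w == v then u else e w.

Lemma eval_term_agree I (e1 e2 : literal S -> universe I) t :
  (forall w, occurs_term w t -> e1 w = e2 w) ->
  @eval_term S (with_lits I e1) t = @eval_term S (with_lits I e2) t.
Proof.
elim: t => [v|s ts IH] /= H; first exact: H.
congr (iop _); apply: funext => i; apply: IH => w wi.
by apply: H; apply/existsP; exists i.
Qed.

Lemma eval_agree I phi (e1 e2 : literal S -> universe I) :
  (forall w, occurs w phi -> e1 w = e2 w) ->
  eval (with_lits I e1) phi = eval (with_lits I e2) phi.
Proof.
elim: phi e1 e2 => [r ts|p IHp q IHq|v p IH] e1 e2 /= H.
- have -> : (fun i => @eval_term S (with_lits I e1) (ts i)) =
            (fun i => @eval_term S (with_lits I e2) (ts i)).
    apply: funext => i; apply: eval_term_agree => w wi.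
    by apply: H; apply/existsP; exists i.
  by [].
- by rewrite (IHp e1 e2) ?(IHq e1 e2) // => w wp; apply: H; rewrite wp ?orbT.
- congr asbool; apply: eq_exists => u; congr (is_true _).
  apply: (IH (update _ e1 v u) (update _ e2 v u)) => w wp.
  by rewrite /update; case: eqP => // _; apply: H; rewrite wp orbT.
Qed.

Lemma eval_term_rename I v1 v2 t (e : literal S -> universe I) :
  @eval_term S (with_lits I e) (rename_term v1 v2 t) =
  @eval_term S (with_lits I (update _ e v1 (e v2))) t.
Proof.
elim: t => [w|s ts IH] /=; last by congr (iop _); exact: funext.
by rewrite /rename_lit /update; case: eqP.
Qed.

(** As [v2] is fresh, no binder of [phi] captures it. A binder [v1] turns into [v2]; the two
    environments then differ at most at [v2], which [phi] cannot see. *)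
Lemma eval_rename I v1 v2 phi (e : literal S -> universe I) :
  ~~ occurs v2 phi ->
  eval (with_lits I e) (rename v1 v2 phi) =
  eval (with_lits I (update _ e v1 (e v2))) phi.
Proof.
elim: phi e => [r ts|p IHp q IHq|w p IH] e /=.
- move=> _; congr (eval_atom _); apply: funext => i; exact: eval_term_rename.
- by rewrite negb_or => /andP[v2p v2q]; rewrite IHp ?IHq.
- rewrite negb_or => /andP[v2w v2p].
  congr asbool; apply: eq_exists => u; congr (is_true _).
  etransitivity; first exact: (IH (update _ e (rename_lit v1 v2 w) u) v2p).
  apply: eval_agree => x xp.
  have xv2 : x != v2 by apply: contraNneq v2p => <-.
  rewrite /rename_lit /update /=; case: (eqVneq w v1) => [->|wv1].
    by rewrite !eqxx (negPf xv2); case: (x == v1).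
  rewrite (negPf v2w); case: (eqVneq x v1) => [->|//].
  by rewrite eq_sym (negPf wv1).
Qed.

Lemma eval_subst_term I v t u :
  eval_term I (subst_term v t u) = @eval_term S (reassign v (eval_term I t)) u.
Proof.
elim: u => [w|s us IH] /=; last by congr (iop _); exact: funext.
by case: eqP.
Qed.

Lemma eval_subst (fr : fresh_choice S) I v t phi (e : literal S -> universe I) :
  eval (with_lits I e) (subst fr v t phi) =
  eval (with_lits I (update _ e v (@eval_term S (with_lits I e) t))) phi.
Proof.
(* Structural induction would not do: below a quantifier, [subst] recurses into a renamed copy of
   the body. *)
have [n] := ubnP (height phi); elim: n => // n IHn in phi e *.
case: phi => [r ts|p q|w p]; rewrite [height _]/= ltnS => hn.
- rewrite subst_Atom /=; congr (eval_atom _); apply: funext => i.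
  exact: (eval_subst_term (with_lits I e)).
- move: hn; rewrite gtn_max => /andP[hp hq].
  by rewrite subst_Nor /= !IHn.
- rewrite subst_Ex /=; set v' := fr w p v t.
  have [v'v v't v'p] := freshP fr w p v t; rewrite -/v' in v'v v't v'p.
  congr asbool; apply: eq_exists => u; congr (is_true _).
  etransitivity.
    by apply: (IHn _ (update _ e v' u)); rewrite height_rename.
  etransitivity; first exact: eval_rename.
  (* The environments may disagree only at [v'], which does not occur in [p]. At [v] both hold the
     value of [t], which ignores [v'] because [v'] does not occur in [t]. *)
  apply: eval_agree => x xp.
  have xv' : x != v' by apply: contraNneq v'p => <-.
  rewrite /update /= eqxx (negPf v'v) (negPf xv').
  case: (eqVneq x w) => // xw; case: (eqVneq x v) => // xv.
  apply: eval_term_agree => y yt.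
  by case: eqP => // yv'; rewrite -yv' yt in v't.
Qed.

Lemma height_subst (fr : fresh_choice S) v t phi :
  height (subst fr v t phi) = height phi.
Proof.
have [n] := ubnP (height phi); elim: n => // n IHn in phi *.
case: phi => [r ts|p q|w p]; rewrite [height _]/= ltnS => hn //.
- move: hn; rewrite gtn_max => /andP[hp hq].
  by rewrite subst_Nor /= !IHn.
- by rewrite subst_Ex /= IHn height_rename.
Qed.

End Evaluation.

(** * Atoms over the equality symbol *)

Section Equality.
Variable S : language.

Lemma nargs_equ : nargs (sval (equ_rel S)) = 2.
Proof. by rewrite /nargs /= arity_equ. Qed.

Definition equ_fst : 'I_(nargs (sval (equ_rel S))) :=
  cast_ord (esym nargs_equ) ord0.
Definition equ_snd : 'I_(nargs (sval (equ_rel S))) :=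
  cast_ord (esym nargs_equ) ord_max.

(** The index type has two elements only up to a proof about the arity, so an arbitrary argument
    family has to be matched with the one in [Equ] position by position. *)
Lemma Atom_equ (ts : 'I_(nargs (sval (equ_rel S))) -> term S) :
  Atom ts = Equ (ts equ_fst) (ts equ_snd).
Proof.
congr (Atom _); apply: funext => i.
have : val i < 2 by rewrite -nargs_equ; exact: ltn_ord.
case: eqP => [i0|i0]; first by move=> _; congr (ts _); apply: val_inj.
case Ei: (val i) i0 => [|[|k]] //= _ _.
by congr (ts _); apply: val_inj.
Qed.

Lemma eval_atom_equ (I : interpretation S)
    (us : 'I_(nargs (sval (equ_rel S))) -> universe I) :
  eval_atom us = true <-> us equ_fst = us equ_snd.
Proof.
rewrite /eval_atom eqxx; split=> [/asboolP H|H]; first exact: H.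
apply/asboolP => i j i0 j1.
have -> : i = equ_fst by apply: val_inj.
by have -> : j = equ_snd by apply: val_inj.
Qed.

End Equality.

(** * Closure of [X] under the base rules, and the atomic case *)

Section BaseRuleClosure.
Variables (S : language) (fr : fresh_choice S) (D : ruleset S).
Variable X : set (formula S).
Hypothesis emu : emulates_from_empty D (base_rules fr).

Lemma provable_base (R : rule S) (Gamma : {fset formula S}) phi :
  base_rules fr R -> R set0 (Gamma, phi) -> [set` Gamma] `<=` X ->
  provable D X phi.
Proof.
move=> baseR Rphi GX.
have : (\bigcup_(n in [set n | 1 <= n]) iter n (step D) set0) (Gamma, phi).
  by apply: emu; exists 1 => //=; exists R.
by move=> [n _ Dphi]; exists n, Gamma.
Qed.

Lemma provable_assume phi : X phi -> provable D X phi.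
Proof.
move=> Xphi; apply: (@provable_base (@R_assume S) [fset phi]%fset).
- by rewrite /base_rules /=; tauto.
- by exists phi.
- by move=> x /=; rewrite inE => /eqP ->.
Qed.

Lemma henkin_sim_refl t : henkin_sim D X t t.
Proof.
apply: (@provable_base (@R_refl S) fset0%fset).
- by rewrite /base_rules /=; tauto.
- by exists t.
- by move=> x /=; rewrite inE.
Qed.

Hypothesis closedX : Prov D X `<=` X.

(** This lets equivalences serve as premises of the rules, since premises must lie in [X]. *)
Lemma henkin_simE t1 t2 : henkin_sim D X t1 t2 <-> X (Equ t1 t2).
Proof. by split=> [/closedX|/provable_assume]. Qed.

Lemma henkin_sim_sym t1 t2 : henkin_sim D X t1 t2 -> henkin_sim D X t2 t1.
Proof.
move=> /henkin_simE X12; apply: (@provable_base (@R_sym S) [fset Equ t1 t2]%fset).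
- by rewrite /base_rules /=; tauto.
- by exists t1, t2.
- by move=> x /=; rewrite inE => /eqP ->.
Qed.

Lemma henkin_sim_trans t1 t2 t3 :
  henkin_sim D X t1 t2 -> henkin_sim D X t2 t3 -> henkin_sim D X t1 t3.
Proof.
move=> /henkin_simE X12 /henkin_simE X23.
apply: (@provable_base (@R_trans S) [fset Equ t1 t2; Equ t2 t3]%fset).
- by rewrite /base_rules /=; tauto.
- by exists t1, t2, t3.
- by move=> x /=; rewrite !inE => /orP[] /eqP ->.
Qed.

Lemma henkin_sim_App (s : opsym S) (ts ts' : 'I_(nargs (sval s)) -> term S) :
  (forall i, henkin_sim D X (ts i) (ts' i)) ->
  henkin_sim D X (App ts) (App ts').
Proof.
move=> simts; apply: (@provable_base (@R_plus S)
  [fset Equ (ts j) (ts' j) | j in 'I_(nargs (sval s))]%fset).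
- by rewrite /base_rules /=; tauto.
- by exists s, ts, ts'.
- by move=> x /= /imfsetP[i _ ->]; apply/henkin_simE.
Qed.

Lemma mem_Atom_sim (r : relsym S) (ts ts' : 'I_(nargs (sval r)) -> term S) :
  (forall i, henkin_sim D X (ts i) (ts' i)) -> X (Atom ts) -> X (Atom ts').
Proof.
move=> simts Xts; apply: closedX; apply: (@provable_base (@R_rel S)
  ([fset Equ (ts j) (ts' j) | j in 'I_(nargs (sval r))]
    `|` [fset Atom ts])%fset).
- by rewrite /base_rules /=; tauto.
- by exists r, ts, ts'.
- move=> x /=; rewrite in_fsetU => /orP[/imfsetP[i _ ->]|].
    exact/henkin_simE.
  by rewrite inE => /eqP ->.
Qed.

Lemma mem_Nor_swap phi1 phi2 phi3 phi4 :
  X (Nor phi1 phi2) -> X (Nor phi3 phi4) -> X (Nor phi2 phi3).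
Proof.
move=> X12 X34; apply: closedX.
apply: (@provable_base (@R_nor S) [fset Nor phi1 phi2; Nor phi3 phi4]%fset).
- by rewrite /base_rules /=; tauto.
- by exists phi1, phi2, phi3, phi4.
- by move=> x /=; rewrite !inE => /orP[] /eqP ->.
Qed.

Lemma mem_Ex_subst psi v t : X (subst fr v t psi) -> X (Ex v psi).
Proof.
move=> Xpsi; apply: closedX.
apply: (@provable_base (R_exists fr) [fset subst fr v t psi]%fset).
- by rewrite /base_rules /=; tauto.
- by exists psi, v, t.
- by move=> x /=; rewrite inE => /eqP ->.
Qed.

(** The NOR rule keeps the inner two of four components. From [Nor phi psi] it gives the swapped
    formula, and the two together give both negations; conversely the two negations give
    [Nor phi psi]. *)
Lemma mem_Nor phi psi :
  mincover X -> X (Nor phi psi) <-> ~ X phi /\ ~ X psi.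
Proof.
move=> coverX; split=> [Xn|[nXphi nXpsi]].
  have Xn' : X (Nor psi phi) := mem_Nor_swap _ _ _ _ Xn Xn.
  split=> /coverX; apply; first exact: mem_Nor_swap Xn' Xn.
  exact: mem_Nor_swap Xn Xn'.
have XNeg chi : ~ X chi -> X (Neg chi).
  by move=> nX; apply: contrapT => nXN; apply: nX; apply/coverX.
exact: mem_Nor_swap (XNeg _ nXphi) (XNeg _ nXpsi).
Qed.

Lemma eval_term_henkin t : eval_term (henkin D X) t = henkin_proj D X t.
Proof.
elim: t => [//|s ts IH].
rewrite -[RHS](henkin_iop henkin_sim_refl henkin_sim_sym henkin_sim_trans).
  by congr (@iop S (henkin D X) s _); exact: funext.
exact: henkin_sim_App.
Qed.

Lemma eval_Atom_henkin (r : relsym S) (ts : 'I_(nargs (sval r)) -> term S) :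
  eval (henkin D X) (Atom ts) = true <-> X (Atom ts).
Proof.
have -> : eval (henkin D X) (Atom ts) =
    eval_atom (I := henkin D X) (fun i => henkin_proj D X (ts i)).
  by congr (eval_atom _); apply: funext => i; apply: eval_term_henkin.
have [rE|rN] := eqVneq r (equ_rel S).
  (* Equality is evaluated as identity of classes, which is what the quotient by provable equality
     provides. *)
  subst r; rewrite Atom_equ eval_atom_equ -henkin_simE.
  exact: (henkin_projP henkin_sim_refl henkin_sim_sym henkin_sim_trans).
rewrite /eval_atom (negPf rN).
apply: (henkin_irel henkin_sim_refl henkin_sim_sym).
exact: mem_Atom_sim.
Qed.

End BaseRuleClosure.

(** * Truth in the Henkin interpretation as membership in [X] *)

Theorem mainTheorem6 (S : language) (fr : fresh_choice S) (D : ruleset S)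
    (X : set (formula S)) :
  emulates_from_empty D (base_rules fr) ->
  mincover X ->
  Prov D X `<=` X ->
  witnessed X ->
  forall phi : formula S, eval (henkin D X) phi = true <-> X phi.
Proof.
move=> emu coverX closedX witX phi.
have [n] := ubnP (height phi); elim: n => // n IHn in phi *.
case: phi => [r ts|p q|v p]; rewrite [height _]/= ltnS => hn.
- exact: (eval_Atom_henkin _ _ _ _ emu closedX).
- move: hn; rewrite gtn_max => /andP[/IHn IHp /IHn IHq].
  rewrite (mem_Nor _ _ _ _ emu closedX) // -IHp -IHq /=.
  by split=> [/norP[/negP np /negP nq]|[/negP np /negP nq]] //; apply/norP.
split=> [/asboolP[u pu]|Xp].
  (* Every element of the universe is the class of some term [t], and this [t] is the instance fed
     to the existential rule. *)
  case: u pu => C [t Ct] pu.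
  apply: (mem_Ex_subst _ _ _ _ emu closedX _ _ t).
  apply/IHn; first by rewrite height_subst.
  (* By conversion, [henkin D X] is [with_lits] applied to its own literal values. *)
  rewrite (eval_subst _ fr (henkin D X) v t p (ilit (henkin D X))).
  rewrite [eval_term _ _](eval_term_henkin _ _ _ _ emu closedX).
  move: pu; rewrite (_ : exist _ C _ = henkin_proj D X t) //.
  exact: eq_exist.
have [v2 [v2p Xp2]] := witX _ _ Xp.
(* Renaming [v] to [v2] amounts to reassigning [v] to the class of [v2]. *)
apply/asboolP; exists (ilit (henkin D X) v2).
have /IHn[_ /(_ Xp2)] : height (rename v v2 p) < n by rewrite height_rename.
by rewrite (eval_rename _ (henkin D X) v v2 p (ilit (henkin D X)) v2p).
Qed.
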